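(* Let $$L=\begin{pmatrix}1&0&0\\1&1&0\\0&0&1\end{pmatrix},\quad R=\begin{pmatrix}1&1&0\\0&1&0\\0&0&1\end{pmatrix},\quad I=\begin{pmatrix}1&0&1\\1&0&0\\0&1&0\end{pmatrix},$$ and let $\mathfrak m(X)$ denote the $3\times3$ matrix associated to a rational pair $X\in\overline\triangle$ different from the vertices of $\overline\triangle$. (1) Let $\frac ab\in\mathbb Q\cap(0,1)$ and let $[a_1,\ldots,a_n]$ be its continued fraction expansion. Then $$\mathfrak m\left(\frac ab,\frac ab\right)=\begin{cases}\mathfrak m\left(\frac12,\frac12\right)L^{a_1-1}R^{a_2}\cdots L^{a_{n-1}}R^{a_n-1} & \text{if } n\text{ is even},\\ \mathfrak m\left(\frac12,\frac12\right)L^{a_1-1}R^{a_2}\cdots R^{a_{n-1}}L^{a_n-1} & \text{if } n\text{ is odd}.\end{cases}$$ The same right multiplication yields $\mathfrak m\left(\frac ab,0\right)$ from $\mathfrak m\left(\frac12,0\right)$ and $\mathfrak m\left(1,\frac ab\right)$ from $\mathfrak m\left(1,\frac12\right)$. (2) Let $\left(\frac pq,\frac rq\right)$ be the interior rational pair with representation $([\alpha_0,\ldots,\alpha_k],[a_1,\ldots,a_n])$. Then $$\mathfrak m\left(\frac pq,\frac rq\right)=\begin{cases}\mathfrak m\left(\frac12,\frac12\right)L^{\alpha_0}I\cdots L^{\alpha_{k-1}}IL^{\alpha_k-1}IL^{a_1-1}R^{a_2}\cdots L^{a_{n-1}}R^{a_n-1} & \text{if } n\text{ is even},\\ \mathfrak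 m\left(\frac12,\frac12\right)L^{\alpha_0}I\cdots L^{\alpha_{k-1}}IL^{\alpha_k-1}IL^{a_1-1}R^{a_2}\cdots R^{a_{n-1}}L^{a_n-1} & \text{if } n\text{ is odd}.\end{cases}$$ (When $n=1$ the block $L^{a_1-1}R^{a_2}\cdots R^{a_{n-1}}L^{a_n-1}$ is to be read as $L^{a_1-2}$.)
   Context: **Triangle and maps.** $\triangle=\{(x,y)\in\mathbb R^2: 1\ge x\ge y>0\}$, $\overline\triangle=\{1\ge x\ge y\ge 0\}$, with vertices $(0,0),(1,0),(1,1)$; $\Sigma=\overline\triangle\cap\{x=y\}$, $\Lambda=\{(x,0):0\le x\le1\}$, $\Upsilon=\overline\triangle\cap\{x=1\}$. For $k\ge0$, $\triangle_k=\{(x,y)\in\triangle: 1-x-ky\ge0>1-x-(k+1)y\}$; then $\overline\triangle$ is the disjoint union of $\Lambda$ and the $\triangle_k$. The Triangle Map is $T:\triangle\to\overline\triangle$, $T(x,y)=\left(\frac yx,\frac{1-x-ky}{x}\right)$ for $(x,y)\in\triangle_k$. The maps $\phi_0(x,y)=\left(\frac1{1+y},\frac x{1+y}\right)$ and $\phi_1(x,y)=\left(\frac x{1+y},\frac y{1+y}\right)$ are considered on all of $\overline\triangle$, and $\phi_2:\Sigma\to\Lambda$ is $\phi_2(x,x)=(x,0)$. For a finite word $\omega=\omega_0\cdots\omega_{n-1}\in\{0,1\}^*$, $\phi_\omega=\phi_{\omega_0}\circ\cdots\circ\phi_{\omega_{n-1}}$ (identity for the empty word). $\ell$ is the open segment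 joining $(1,0)$ and $\left(\frac12,\frac12\right)$; note $\ell=\{\phi_1\phi_0\phi_2(\xi,\xi):0<\xi<1\}$. **Representation.** A point of $\triangle$ has finite triangle sequence $[\alpha_0,\ldots,\alpha_k]$ if $T^j(x,y)\in\triangle_{\alpha_j}$ for $0\le j\le k$ and $T^{k+1}(x,y)\in\Lambda$. Every rational pair in the interior of $\overline\triangle$ has a finite triangle sequence, with $\alpha_k\ge1$, and there is a unique $\xi\in(0,1)$, which is rational, with $\left(\frac pq,\frac rq\right)=\phi_1^{\alpha_0}\phi_0\cdots\phi_1^{\alpha_k}\phi_0\phi_2(\xi,\xi)$. Its representation is $([\alpha_0,\ldots,\alpha_k],[a_1,\ldots,a_n])$, where $[a_1,\ldots,a_n]$ is the continued fraction expansion of $\xi$, with $a_n>1$ when $n>1$. **Parents.** A rational number $\frac ab\in(0,1)$ in lowest terms is in a unique way $\frac{l+r}{m+s}$ with $\frac lm<\frac rs$ fractions of non-negative integers in lowest terms, $m,s\ge1$, $rm-ls=1$, $a=l+r$, $b=m+s$; $\frac lm$ and $\frac rs$ are its left and right Farey parents. Every rational pair in $\overline\triangle$ different from the vertices lies on exactly one of the following segments, each oriented by its parameter $\xi\in(0,1)$: $\Sigma$ with $\theta(\xi)=(\xi,\xi)$; $\Lambda$ with $\theta(\xi)=(\xi,0)$; $\Upsilon$ with $\theta(\xi)=(1,\xi)$; $\phi_\omega(\ell)$, $\omega\in\{0,1\}^*$, with $\theta(\xi)=\phi_\omega\phi_1\phi_0\phi_2(\xi,\xi)$. The left (right) parent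 of $\theta\left(\frac ab\right)$ is $\theta\left(\frac lm\right)$ (resp. $\theta\left(\frac rs\right)$), with $\frac lm,\frac rs$ the left and right Farey parents of $\frac ab$ and $\theta$ extended to $[0,1]$ by the same formula. **The matrix $\mathfrak m$.** A rational pair $\left(\frac pq,\frac rq\right)$, written with its least common positive denominator $q$, is expressed as the column vector $(q,p,r)^{T}$. For a rational pair $X\in\overline\triangle$ different from the vertices, $\mathfrak m(X)$ is the $3\times3$ matrix whose first column is the right parent of $X$, whose second column is the left parent of $X$, and whose third column is: the vertex of $\overline\triangle$ opposite to the side containing $X$, if $X$ is a boundary point; $\phi_\omega(1,1)$, if $X\in\phi_\omega(\ell)$ with $\omega\in\{0,1\}^*$ (all expressed as vectors). In particular $$\mathfrak m\left(\tfrac12,\tfrac12\right)=\begin{pmatrix}1&1&1\\1&0&1\\1&0&0\end{pmatrix},\ \mathfrak m\left(\tfrac12,0\right)=\begin{pmatrix}1&1&1\\1&0&1\\0&0&1\end{pmatrix},\ \mathfrak m\left(1,\tfrac12\right)=\begin{pmatrix}1&1&1\\1&1&0\\1&0&0\end{pmatrix}.$$ *)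

(* Defs.v *)
From HB Require Import structures.
From mathcomp Require Import all_boot all_order all_algebra.
From mathcomp Require Import classical_sets.

Set Implicit Arguments.
Unset Strict Implicit.
Unset Printing Implicit Defensive.

Import Order.TTheory GRing.Theory Num.Theory.
Local Open Scope ring_scope.

(* Only rational points are involved: the Triangle Map and the maps phi_i
   preserve rationality, and a point of one of the segments below is rational
   iff its parameter is. *)
Definition point : Type := (rat * rat)%type.

Definition in_triangle (X : point) : bool :=
  [&& X.1 <= 1, X.2 <= X.1 & 0 < X.2].

Definition in_triangle_interior (X : point) : bool :=
  [&& X.1 < 1, X.2 < X.1 & 0 < X.2].

Definition in_Lambda (X : point) : bool := (0 <= X.1 <= 1) && (X.2 == 0).

Definition in_triangle_k (k : nat) (X : point) : bool :=
  [&& in_triangle X, 0 <= 1 - X.1 - k%:R * X.2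
    & 1 - X.1 - k.+1%:R * X.2 < 0].

(* For X in the triangle the index k is unique; elsewhere the value is junk. *)
Definition triangle_index (X : point) : nat :=
  xget 0%N [set k | in_triangle_k k X]%classic.

Definition triangle_map (X : point) : point :=
  (X.2 / X.1, (1 - X.1 - (triangle_index X)%:R * X.2) / X.1).

Definition phi0 (X : point) : point := (1 / (1 + X.2), X.1 / (1 + X.2)).
Definition phi1 (X : point) : point := (X.1 / (1 + X.2), X.2 / (1 + X.2)).

(* Only meaningful (and only used) on the diagonal. *)
Definition phi2 (X : point) : point := (X.1, 0).

(* The letters 0 and 1 are encoded as false and true; the first letter is the
   outermost map. *)
Definition phi (b : bool) : point -> point := if b then phi1 else phi0.
Definition phi_word (w : seq bool) (X : point) : point := foldr phi X w.

(* [a_1, ..., a_n] = 1 / (a_1 + 1 / (a_2 + ... + 1 / a_n)) *)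
Definition cf_value (a : seq nat) : rat :=
  foldr (fun ai x => (ai%:R + x)^-1) 0 a.

Definition cf_expansion (xi : rat) (a : seq nat) : Prop :=
  [/\ a != [::], all (leq 1) a, (1 < size a)%N -> (1 < last 0%N a)%N
    & cf_value a = xi].

Definition triangle_sequence (X : point) (alpha : seq nat) : Prop :=
  [/\ alpha != [::],
      forall j, (j < size alpha)%N ->
        in_triangle_k (nth 0%N alpha j) (iter j triangle_map X)
    & in_Lambda (iter (size alpha) triangle_map X)].

Definition representation (X : point) (alpha a : seq nat) : Prop :=
  triangle_sequence X alpha /\
  exists xi : rat,
    [/\ 0 < xi < 1,
        X = foldr (fun k Y => iter k phi1 (phi0 Y)) (phi2 (xi, xi)) alpha
      & cf_expansion xi a].

(* numq and denq give the fraction in lowest terms, with positive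
   denominator. *)
Definition farey_parents (x l r : rat) : Prop :=
  [/\ 0 <= l < r,
      numq r * denq l - numq l * denq r = 1,
      numq x = numq l + numq r
    & denq x = denq l + denq r].

Definition farey_left_right (x : rat) : rat * rat :=
  xget (0, 0) [set p | farey_parents x p.1 p.2]%classic.

(* The sides of the triangle, and the segments phi_w(ell). *)
Inductive segment : Type :=
  | Sigma | Lambda | Upsilon | Inner of seq bool.

Definition segment_code (s : segment) : 'I_3 + seq bool :=
  match s with
  | Sigma => inl (inord 0)
  | Lambda => inl (inord 1)
  | Upsilon => inl (inord 2)
  | Inner w => inr w
  end.

Definition segment_decode (c : 'I_3 + seq bool) : segment :=
  match c with
  | inl i => nth Sigma [:: Sigma; Lambda; Upsilon] i
  | inr w => Inner w
  end.

Lemma segment_codeK : cancel segment_code segment_decode.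
Proof. by case=> //=; rewrite inordK. Qed.

HB.instance Definition _ := Countable.copy segment (can_type segment_codeK).

Definition theta (s : segment) (xi : rat) : point :=
  match s with
  | Sigma => (xi, xi)
  | Lambda => (xi, 0)
  | Upsilon => (1, xi)
  | Inner w => phi_word w (phi1 (phi0 (phi2 (xi, xi))))
  end.

(* A rational pair other than a vertex lies on exactly one segment, with
   exactly one parameter. *)
Definition segment_param (X : point) : segment * rat :=
  xget (Sigma, 0) [set p | 0 < p.2 < 1 /\ theta p.1 p.2 = X]%classic.

Definition left_parent (X : point) : point :=
  let: (s, xi) := segment_param X in theta s (farey_left_right xi).1.

Definition right_parent (X : point) : point :=
  let: (s, xi) := segment_param X in theta s (farey_left_right xi).2.

(* For a side this is the opposite vertex. *)
Definition opposite_point (s : segment) : point :=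
  match s with
  | Sigma => (1, 0)
  | Lambda => (1, 1)
  | Upsilon => (0, 0)
  | Inner w => phi_word w (1, 1)
  end.

(* (p/q, r/q) |-> (q, p, r)^T, with q the least common denominator. *)
Definition pair_vec (X : point) : 'cV[int]_3 :=
  let q := lcmz (denq X.1) (denq X.2) in
  \col_i nth 0 [:: q; numq (X.1 * q%:~R); numq (X.2 * q%:~R)] i.

Definition frak_m (X : point) : 'M[int]_3 :=
  \matrix_(i, j)
    nth 0 [:: pair_vec (right_parent X) i 0;
              pair_vec (left_parent X) i 0;
              pair_vec (opposite_point (segment_param X).1) i 0] j.

Definition mx3 (rows : seq (seq int)) : 'M[int]_3 :=
  \matrix_(i, j) nth 0 (nth [::] rows i) j.

Definition matL : 'M[int]_3 := mx3 [:: [:: 1; 0; 0]; [:: 1; 1; 0]; [:: 0; 0; 1]].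
Definition matR : 'M[int]_3 := mx3 [:: [:: 1; 1; 0]; [:: 0; 1; 0]; [:: 0; 0; 1]].
Definition matI : 'M[int]_3 := mx3 [:: [:: 1; 0; 1]; [:: 1; 0; 0]; [:: 0; 1; 0]].

(* L^(a_1 - 1) R^(a_2) L^(a_3) ... (L or R)^(a_n - 1): the powers alternate
   starting from L, so that the last one is of R for n even and of L for n odd;
   for n = 1 this is L^(a_1 - 2).  Indices are shifted: nth 0 a i is a_(i+1). *)
Definition cf_block (a : seq nat) : 'M[int]_3 :=
  \prod_(i < size a)
    (if odd i then matR else matL)
      ^+ (nth 0%N a i - (i == 0%N :> nat) - (i.+1 == size a :> nat)).

(* L^(alpha_0) I ... L^(alpha_(k-1)) I L^(alpha_k - 1) I *)
Definition triangle_block (alpha : seq nat) : 'M[int]_3 :=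
  \prod_(j < size alpha)
    (matL ^+ (nth 0%N alpha j - (j.+1 == size alpha :> nat)) * matI).

(* Main.v *)
Require Import Defs.
From mathcomp Require Import all_boot all_order all_algebra.
From mathcomp Require Import zify ring lra.
Import Order.TTheory GRing.Theory Num.Theory.
Local Open Scope ring_scope.

(** Everything is linear in homogeneous coordinates.  Each map [phi b] is induced
    by a unimodular matrix [phi_mx b] with non-negative entries, so it carries
    the primitive integer vector of a rational point to the primitive integer
    vector of its image.  Hence every segment [s] has an integer matrix
    [segment_mx s] sending [(q, p, 0)] to the vector of [theta s (p / q)] when
    [p / q] is in lowest terms, and [(0, 0, 1)] to the vector of the point that
    gives the third column of [frak_m].  Since a point determines its segment and
    its parameter ([theta_inj]), [frak_m (theta s xi)] is [segment_mx s] times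
    the matrix of the Farey parents of [xi] ([frak_m_theta]).

    Right multiplication by a power of [matL] or [matR] adds a multiple of one
    parent to the other one, which is a run of left or right steps in the
    Stern-Brocot tree.  Following the continued fraction of [xi] down the tree
    shows that the matrix of the Farey parents of [xi] is that of [1 / 2] times
    [cf_block a] ([cf_block_farey]).  So [frak_m (theta s xi)] is
    [frak_m (theta s (1 / 2)) * cf_block a] for every segment [s]; the three
    sides give the first part of the theorem.

    For an interior point the segment is [Inner w], where the word [w] is read
    off the triangle sequence, whose last digit is positive
    ([triangle_sequence_last]).  The matrix [H = frak_m (1 / 2, 1 / 2)]
    intertwines the letters with the matrices of the theorem:
    [H * matL = phi_mx true * H] and [H * matI = phi_mx false * H]; moreover
    [H * matI] is also the value of [frak_m] at the point of parameter [1 / 2] on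
    [Inner [::]].  Moving [H] through the product turns
    [H * triangle_block alpha] into the value of [frak_m] at the point of
    parameter [1 / 2] on [Inner w] ([triangle_word_mx]). *)

(** * Homogeneous coordinates *)


Definition vec3 (q p r : int) : 'cV[int]_3 := \col_i nth 0 [:: q; p; r] i.

(* Equality of explicit integer matrices with three rows, entry by entry. *)
Ltac mx3_eq :=
  apply/matrixP => -[[|[|[|?]]] ?] // [[|[|[|?]]] ?] //;
  rewrite ?(mxE, big_ord_recl, big_ord0) /=; ring.

Lemma mul_mx3_vec3 a b c d e f g h i q p r :
  mx3 [:: [:: a; b; c]; [:: d; e; f]; [:: g; h; i]] *m vec3 q p r
  = vec3 (a * q + b * p + c * r) (d * q + e * p + f * r) (g * q + h * p + i * r).
Proof. mx3_eq. Qed.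

(** [v] is the primitive vector of homogeneous coordinates of the non-negative
    point [X]; primitivity is a Bezout relation, which unimodular maps visibly
    preserve. *)
Definition represents (X : point) (v : 'cV[int]_3) : Prop :=
  exists q p r : int,
    [/\ v = vec3 q p r, X = (p%:~R / q%:~R, r%:~R / q%:~R),
        [/\ 0 < q, 0 <= p & 0 <= r]
      & exists t u w : int, t * q + u * p + w * r = 1].

Lemma denq_frac_dvd (p q : int) : q != 0 -> (denq (p%:~R / q%:~R) %| q)%Z.
Proof.
move=> q0; set x := _ / _.
have q0' : (q%:~R : rat) != 0 by rewrite intr_eq0.
have e : numq x * q = p * denq x.
  apply: (@intr_inj rat); rewrite !rmorphM /= numqE /x; field.
  by rewrite q0'.
have cop : coprimez (denq x) (numq x).
  by rewrite coprimezE coprime_sym coprime_num_den.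
by rewrite -(Gauss_dvdzr _ cop) e dvdz_mull.
Qed.

Lemma pair_vec_represents X v : represents X v -> pair_vec X = v.
Proof.
case=> q [p [r [-> -> [q0 _ _] [t [u [w bez]]]]]].
have qn0 : q != 0 by rewrite gt_eqF.
rewrite /pair_vec /=; set Q := lcmz _ _.
have Qgt0 : 0 < Q.
  by rewrite lt_def lcmz_ge0 andbT /Q lcmz_neq0 !denq_neq0.
have QdR : (Q%:~R : rat) != 0 by rewrite intr_eq0 gt_eqF.
have qR : (q%:~R : rat) != 0 by rewrite intr_eq0.
have Qq : (Q %| q)%Z.
  by rewrite /Q /lcmz dvdz_lcm !abszE !normr_denq !denq_frac_dvd.
have num (n : int) : (denq (n%:~R / q%:~R) %| Q)%Z ->
    exists n' : int, n%:~R / q%:~R * Q%:~R = n'%:~R :> rat.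
  move=> /dvdzP[c ->]; exists (numq (n%:~R / q%:~R) * c).
  by rewrite !rmorphM /= numqE; ring.
have [p' ep] := num p (dvdz_lcml _ _).
have [r' er] := num r (dvdz_lcmr _ _).
rewrite ep er !numq_int.
(* The quotient [c] of [q] by the least common denominator [Q] divides the
   primitive vector, so it is 1. *)
have [c ec] := dvdzP Qq.
have cR : (c%:~R : rat) != 0.
  by move: qR; rewrite ec rmorphM /= mulf_eq0 negb_or => /andP[].
have pc : p = p' * c.
  apply: (@intr_inj rat); rewrite rmorphM /= -ep ec rmorphM /=; field.
  by rewrite QdR cR.
have rc : r = r' * c.
  apply: (@intr_inj rat); rewrite rmorphM /= -er ec rmorphM /=; field.
  by rewrite QdR cR.
have c1 : c = 1.
  have cgt0 : 0 < c by move: q0; rewrite ec pmulr_lgt0.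
  have : c * (t * Q + u * p' + w * r') = 1 by rewrite -bez pc rc ec; ring.
  move: (t * Q + _ + _) => z; have [z0|z0] := lerP z 0; nia.
by rewrite pc rc ec c1 !mulr1 mul1r.
Qed.

(** The action of [phi b] on homogeneous coordinates: [(q, p, r)] is sent to
    [(q + r, q, p)] by the letter 0 and to [(q + r, p, r)] by the letter 1. *)
Definition phi_mx (b : bool) : 'M[int]_3 :=
  if b then mx3 [:: [:: 1; 0; 1]; [:: 0; 1; 0]; [:: 0; 0; 1]]
  else mx3 [:: [:: 1; 0; 1]; [:: 1; 0; 0]; [:: 0; 1; 0]].

Lemma represents_phi b X v :
  represents X v -> represents (phi b X) (phi_mx b *m v).
Proof.
case=> q [p [r [-> -> [q0 p0 r0] [t [u [w bez]]]]]].
have qR : (q%:~R : rat) != 0 by rewrite intr_eq0 gt_eqF.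
have qrR : (q%:~R + r%:~R : rat) != 0.
  by rewrite -rmorphD /= intr_eq0 gt_eqF // ltr_wpDr.
case: b; rewrite /phi_mx mul_mx3_vec3.
- exists (q + r), p, r; split; first by congr vec3; ring.
  + by rewrite /phi /phi1 /= rmorphD /=; congr pair; field; rewrite qrR.
  + by split=> //; lia.
  + by exists t, u, (w - t); rewrite -bez; ring.
- exists (q + r), q, p; split; first by congr vec3; ring.
  + by rewrite /phi /phi0 /= rmorphD /=; congr pair; field; rewrite qrR.
  + by split=> //; lia.
  + by exists w, (t - w), u; rewrite -bez; ring.
Qed.

(** The matrix of [phi_word w]. *)
Definition word_mx (w : seq bool) : 'M[int]_3 :=
  foldr (fun b M => phi_mx b *m M) 1%:M w.

Lemma represents_phi_word w X v :
  represents X v -> represents (phi_word w X) (word_mx w *m v).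
Proof.
move=> Xv; elim: w => [|b w IH] /=; first by rewrite mul1mx.
by rewrite -mulmxA; apply: represents_phi.
Qed.

(** The matrix of [theta s]: its first two columns express the coordinates of
    [theta s (p / q)] in terms of [q] and [p], and the third one is the vector of
    [opposite_point s]. *)
Definition segment_mx (s : segment) : 'M[int]_3 :=
  match s with
  | Sigma => mx3 [:: [:: 1; 0; 1]; [:: 0; 1; 1]; [:: 0; 1; 0]]
  | Lambda => mx3 [:: [:: 1; 0; 1]; [:: 0; 1; 1]; [:: 0; 0; 1]]
  | Upsilon => mx3 [:: [:: 1; 0; 1]; [:: 1; 0; 0]; [:: 0; 1; 0]]
  | Inner w =>
      word_mx w *m mx3 [:: [:: 1; 1; 1]; [:: 1; 0; 1]; [:: 0; 1; 1]]
  end.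

Lemma represents_theta s xi : 0 <= xi ->
  represents (theta s xi) (segment_mx s *m vec3 (denq xi) (numq xi) 0).
Proof.
move=> xi0; have d0 := denq_gt0 xi; have n0 : 0 <= numq xi by rewrite numq_ge0.
have dR : ((denq xi)%:~R : rat) != 0 by rewrite intr_eq0 gt_eqF.
have e := divq_num_den xi.
have [[t u] bez] : exists tu : int * int, tu.1 * denq xi + tu.2 * numq xi = 1.
  have /coprimezP[[t u] /= h] : coprimez (denq xi) (numq xi).
    by rewrite coprimezE coprime_sym coprime_num_den.
  by exists (t, u).
move: (denq xi) (numq xi) d0 n0 dR e bez => d n d0 n0 dR <- /= bez.
case: s => [|||w] /=; rewrite -?mulmxA ?mul_mx3_vec3.
- exists d, n, n; split=> //; [by congr vec3; ring|].
  by exists t, u, 0; rewrite -bez; ring.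
- exists d, n, 0; split=> //; [by congr vec3; ring|by rewrite mul0r|].
  by exists t, u, 0; rewrite -bez; ring.
- exists d, d, n; split; [by congr vec3; ring|by rewrite divff|by split; lia|].
  by exists t, 0, u; rewrite -bez; ring.
- apply: represents_phi_word.
  have -> : vec3 (1 * d + 1 * n + 1 * 0) (1 * d + 0 * n + 1 * 0)
                 (0 * d + 1 * n + 1 * 0)
          = phi_mx true *m (phi_mx false *m vec3 d n 0).
    by rewrite !mul_mx3_vec3; congr vec3; ring.
  apply: (@represents_phi true); apply: (@represents_phi false).
  exists d, n, 0; split=> //; first by rewrite mul0r.
  by exists t, u, 0; rewrite -bez; ring.
Qed.

Lemma represents_opposite s :
  represents (opposite_point s) (segment_mx s *m vec3 0 0 1).
Proof.
case: s => [|||w] /=; rewrite -?mulmxA ?mul_mx3_vec3.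
- by exists 1, 1, 0; split=> //; exists 1, 0, 0.
- by exists 1, 1, 1; split=> //; exists 1, 0, 0.
- by exists 1, 0, 0; split=> //; exists 1, 0, 0.
- apply: represents_phi_word.
  by exists 1, 1, 1; split=> //; exists 1, 0, 0.
Qed.

(** * Each point lies on one segment, with one parameter *)

Lemma phi_interior b X :
  in_triangle_interior X -> in_triangle_interior (phi b X).
Proof.
case: X => x y /and3P[/= x1 yx y0]; have y1 : 0 < 1 + y by lra.
case: b; rewrite /in_triangle_interior /phi /phi1 /phi0 /=;
  by rewrite ltr_pdivrMr // ltr_pM2r ?invr_gt0 // divr_gt0 //; lra.
Qed.

(** Hence [Inner [::]] lies on the line [x + y = 1]. *)
Lemma theta_Inner_nil xi : 0 < xi ->
  theta (Inner [::]) xi = (1 / (1 + xi), xi / (1 + xi)).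
Proof.
move=> xi0; rewrite /= /phi1 /phi0 /phi2 /=.
by congr pair; field; lra.
Qed.

Lemma theta_Inner_interior w xi :
  0 < xi < 1 -> in_triangle_interior (theta (Inner w) xi).
Proof.
case/andP=> xi0 xi1; elim: w => [|b w IH]; last exact: phi_interior.
have y1 : 0 < 1 + xi by lra.
rewrite theta_Inner_nil // /in_triangle_interior /=.
by rewrite ltr_pdivrMr // ltr_pM2r ?invr_gt0 // divr_gt0 //; lra.
Qed.

(** The two maps send the interior to opposite sides of that line. *)
Lemma phi0_sum X : in_triangle_interior X -> 1 < (phi0 X).1 + (phi0 X).2.
Proof.
case: X => x y /and3P[/= x1 yx y0]; have y1 : 0 < 1 + y by lra.
by rewrite -mulrDl ltr_pdivlMr //; lra.
Qed.

Lemma phi1_sum X : in_triangle_interior X -> (phi1 X).1 + (phi1 X).2 < 1.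
Proof.
case: X => x y /and3P[/= x1 yx y0]; have y1 : 0 < 1 + y by lra.
by rewrite -mulrDl ltr_pdivrMr //; lra.
Qed.

Lemma theta_Inner_nil_sum xi : 0 < xi ->
  (theta (Inner [::]) xi).1 + (theta (Inner [::]) xi).2 = 1.
Proof. by move=> xi0; rewrite theta_Inner_nil //= -mulrDl divff //; lra. Qed.

Lemma phi_inj b X Y :
  in_triangle_interior X -> in_triangle_interior Y -> phi b X = phi b Y -> X = Y.
Proof.
case: X Y => x y [x' y'] /and3P[/= _ _ y0] /and3P[/= _ _ y0'].
have h : 1 + y != 0 by lra.
have h' : 1 + y' != 0 by lra.
case: b; rewrite /phi /phi0 /phi1 /= => -[e1 e2].
- have ey : y = y'.
    by move/eqP: e2; rewrite eqr_div // => /eqP; lra.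
  by subst y'; congr pair; apply: (mulIf (invr_neq0 h)).
- have ey : y = y'.
    by move/eqP: e1; rewrite eqr_div // => /eqP; lra.
  by subst y'; congr pair; apply: (mulIf (invr_neq0 h)).
Qed.

(** The inner segments lie in the interior, the sides do not; and the sum of the
    coordinates of a point of [Inner w], compared with 1, tells whether [w] is
    empty, and otherwise which its first letter is. *)
Lemma theta_inj s s' xi xi' : 0 < xi < 1 -> 0 < xi' < 1 ->
  theta s xi = theta s' xi' -> s = s' /\ xi = xi'.
Proof.
move=> h h'; have /andP[xi0 xi1] := h; have /andP[xi0' xi1'] := h'.
have out w X : ~~ in_triangle_interior X -> forall z, 0 < z < 1 ->
    X <> theta (Inner w) z.
  by move=> nX z hz e; move: nX; rewrite e theta_Inner_interior.
have nS z : ~~ in_triangle_interior (theta Sigma z).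
  by rewrite /in_triangle_interior /= ?ltxx ?andbF.
have nL z : ~~ in_triangle_interior (theta Lambda z).
  by rewrite /in_triangle_interior /= ?ltxx ?andbF.
have nU z : ~~ in_triangle_interior (theta Upsilon z).
  by rewrite /in_triangle_interior /= ?ltxx.
case: s s' => [|||w] [|||w'] //; try by [case=> -> | case=> *; lra].
- by move/(out _ _ (nS _) _ h').
- by move/(out _ _ (nL _) _ h').
- by move/(out _ _ (nU _) _ h').
- by move/esym/(out _ _ (nS _) _ h).
- by move/esym/(out _ _ (nL _) _ h).
- by move/esym/(out _ _ (nU _) _ h).
elim: w w' => [|b w IH] [|b' w'].
- move=> e; split=> //; move: e; rewrite !theta_Inner_nil // => -[e _].
  have k : 1 + xi != 0 by lra.
  have k' : 1 + xi' != 0 by lra.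
  by move/eqP: e; rewrite eqr_div // => /eqP; lra.
- move=> e; have := theta_Inner_nil_sum xi xi0; rewrite e /=.
  have := theta_Inner_interior w' xi' h'; case: b' {e} => /=.
    by move/phi1_sum/lt_eqF/eqP.
  by move/phi0_sum/gt_eqF/eqP.
- move=> e; have := theta_Inner_nil_sum xi' xi0'; rewrite -e /=.
  have := theta_Inner_interior w xi h; case: b {e} => /=.
    by move/phi1_sum/lt_eqF/eqP.
  by move/phi0_sum/gt_eqF/eqP.
- have iw := theta_Inner_interior w xi h.
  have iw' := theta_Inner_interior w' xi' h'.
  have [->|neq] := eqVneq b b'.
    by move/(phi_inj _ _ _ iw iw')/IH => -[[->] ->].
  rewrite -[theta (Inner (b :: w)) xi]/(phi b (theta (Inner w) xi)).
  rewrite -[theta (Inner (b' :: w')) xi']/(phi b' (theta (Inner w') xi')).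
  move: (theta _ xi) (theta _ xi') iw iw' => Y Y' iY iY'.
  case: b b' neq => -[] // _ e.
    by have := phi1_sum _ iY; have := phi0_sum _ iY'; rewrite -[phi0 Y']e; lra.
  by have := phi0_sum _ iY; have := phi1_sum _ iY'; rewrite -[phi1 Y']e; lra.
Qed.

Lemma segment_param_theta s xi : 0 < xi < 1 ->
  segment_param (theta s xi) = (s, xi).
Proof.
move=> h; apply: classical_sets.xget_unique => //= -[s' xi'] /= [h' e].
by have [-> ->] := theta_inj _ _ _ _ h' h e.
Qed.

(** * Farey parents as columns of a matrix *)

Lemma farey_parents_uniq x l r l' r' :
  farey_parents x l r -> farey_parents x l' r' -> (l', r') = (l, r).
Proof.
have rat_ext (y z : rat) : numq y = numq z -> denq y = denq z -> y = z.
  by move=> en ed; apply/eqP; rewrite rat_eqE en ed !eqxx.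
case=> _ det en ed [_ det' en' ed'].
have := denq_gt0 l; have := denq_gt0 r; have := denq_gt0 l'.
have := denq_gt0 r'; move=> m's m'0 s0 m0.
(* [denq l] and [denq l'] are both inverse to [numq x] modulo [denq x], and lie
   strictly between 0 and [denq x]. *)
have key : denq l - denq l' = denq x *
   ((numq l - numq l') * denq l - numq l * (denq l - denq l')).
  have k1 : numq x * denq l - denq x * numq l = 1 by rewrite en ed; lia.
  have k2 : numq x * denq l' - denq x * numq l' = 1 by rewrite en' ed'; lia.
  transitivity ((denq l - denq l') * (numq x * denq l - denq x * numq l)).
    by rewrite k1 mulr1.
  have k3 : numq x * (denq l - denq l') = denq x * (numq l - numq l') by lia.
  transitivity (denq l * (numq x * (denq l - denq l'))
      - denq x * numq l * (denq l - denq l')); first by ring.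
  by rewrite k3; ring.
move: (_ - numq l * _) key => k key.
have k0 : k = 0.
  have lt1 : denq l - denq l' < denq x by lia.
  have lt2 : - denq x < denq l - denq l' by lia.
  have [k1|k1|//] := ltgtP k 0; nia.
have dl : denq l' = denq l by move: key; rewrite k0 mulr0; lia.
have dr : denq r' = denq r by lia.
have nl : numq l' = numq l by nia.
have nr : numq r' = numq r by lia.
by rewrite (rat_ext _ _ nl dl) (rat_ext _ _ nr dr).
Qed.

(** The vectors [(denq, numq)] of the right and left parents, bordered by 1. *)
Definition farey_mx (l r : rat) : 'M[int]_3 :=
  mx3 [:: [:: denq r; denq l; 0]; [:: numq r; numq l; 0]; [:: 0; 0; 1]].

Lemma frak_m_theta s x l r : 0 < x < 1 -> farey_parents x l r ->
  frak_m (theta s x) = segment_mx s * farey_mx l r.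
Proof.
move=> x01 fp; have [/andP[l0 lr] _ _ _] := fp.
have flr : farey_left_right x = (l, r).
  by apply: classical_sets.xget_unique => //= -[l' r'] /=; apply: farey_parents_uniq.
rewrite /frak_m /left_parent /right_parent segment_param_theta // flr /=.
rewrite (pair_vec_represents _ _ (represents_theta s _ l0)).
have r0 := ltW (le_lt_trans l0 lr).
rewrite (pair_vec_represents _ _ (represents_theta s _ r0)).
rewrite (pair_vec_represents _ _ (represents_opposite s)) -mulmxE.
move: (segment_mx s) => M; apply/matrixP => i [[|[|[|j]]] hj] //.
all: rewrite !mxE /= ?mxE; apply: eq_bigr => k _; rewrite !mxE.
all: by case: k => [[|[|[|]]]].
Qed.

(** * Continued fractions and the Stern-Brocot tree *)

(** The matrix [farey_mx (l / m) (r / s)], from the numerators and denominators;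
    [parent_mx 1 1 1 0] is that of the parents [0 / 1] and [1 / 1] of [1 / 2]. *)
Definition parent_mx (s m r l : int) : 'M[int]_3 :=
  mx3 [:: [:: s; m; 0]; [:: r; l; 0]; [:: 0; 0; 1]].

Lemma parent_mxL s m r l k :
  parent_mx s m r l * matL ^+ k
  = parent_mx (s + k%:Z * m) m (r + k%:Z * l) l.
Proof.
elim: k => [|k IH]; first by rewrite mulr1 !mul0r !addr0.
by rewrite exprSr mulrA IH -mulmxE intS; mx3_eq.
Qed.

Lemma parent_mxR s m r l k :
  parent_mx s m r l * matR ^+ k
  = parent_mx s (m + k%:Z * s) r (l + k%:Z * r).
Proof.
elim: k => [|k IH]; first by rewrite mulr1 !mul0r !addr0.
by rewrite exprSr mulrA IH -mulmxE intS; mx3_eq.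
Qed.

(** Alternating powers of [matL] and [matR], starting with [matR] iff [b], with
    1 subtracted from the last exponent only: the tail of [cf_block]. *)
Fixpoint alt_block (b : bool) (a : seq nat) : 'M[int]_3 :=
  if a is k :: a' then
    (if b then matR else matL) ^+ (k - (a' == [::])) * alt_block (~~ b) a'
  else 1.

Lemma alt_blockE b a : alt_block b a =
  \prod_(i < size a) (if odd i (+) b then matR else matL)
      ^+ (nth 0%N a i - (i.+1 == size a :> nat)).
Proof.
elim: a b => [|k a IH] b /=; first by rewrite big_ord0.
rewrite big_ord_recl /= IH; congr (_ ^+ (_ - _) * _).
  by case: a {IH}.
by apply: eq_bigr => i _; rewrite /= addbN addNb.
Qed.

Lemma cf_block_cons k a :
  cf_block (k :: a) = matL ^+ (k - 1 - (a == [::])) * alt_block true a.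
Proof.
rewrite alt_blockE /cf_block big_ord_recl /=; congr (_ ^+ (_ - _) * _).
  by case: a.
by apply: eq_bigr => i _; rewrite /= addbT subn0.
Qed.

(** [l / m] and [r / s] are the left and right Farey parents of [x], with
    denominators cleared. *)
Definition is_farey_pair (x : rat) (s m r l : int) : Prop :=
  [/\ 0 < s, 0 < m & 0 <= l] /\
  r * m - l * s = 1 /\ x * (s%:~R + m%:~R) = r%:~R + l%:~R.

Lemma cf_value_ge0 a : 0 <= cf_value a.
Proof.
elim: a => [|k a IH] //=; by rewrite invr_ge0 addr_ge0.
Qed.

(** With [y = cf_value a] for the remaining digits [a], and columns [(s, r)] and
    [(m, l)] in the current matrix, [x] is [(r + l y) / (s + m y)] or
    [(r y + l) / (s y + m)], according as the next step is a power of [matR] or of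
    [matL].  This form is kept by each step, because [y = 1 / (k + y')]; the last
    digit [k] has [y = 1 / k], and the exponent [k - 1] leaves [x] as the mediant
    of the two columns. *)
Lemma alt_block_farey x b a s m r l :
  a != [::] -> all (leq 1) a ->
  0 < s -> 0 < m -> 0 <= r -> 0 <= l -> r * m - l * s = 1 ->
  (if b then x * (s%:~R + m%:~R * cf_value a) = r%:~R + l%:~R * cf_value a
   else x * (s%:~R * cf_value a + m%:~R) = r%:~R * cf_value a + l%:~R) ->
  exists s' m' r' l', parent_mx s m r l * alt_block b a = parent_mx s' m' r' l'
    /\ is_farey_pair x s' m' r' l'.
Proof.
elim: a b s m r l => // k a IH b s m r l _ /= /andP[k1 ak] s0 m0 r0 l0 det hx.
have y0 := cf_value_ge0 a.
have kR : 0 < (k%:R : rat) by rewrite ltr0n.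
have d0 : k%:R + cf_value a != 0 by rewrite gt_eqF // ltr_pwDl.
have {}hx : if b then x * (s%:~R * (k%:R + cf_value a) + m%:~R)
                = r%:~R * (k%:R + cf_value a) + l%:~R
            else x * (s%:~R + m%:~R * (k%:R + cf_value a))
                = r%:~R + l%:~R * (k%:R + cf_value a).
  by case: b hx => /(congr1 ( *%R (k%:R + cf_value a))) e;
    apply: etrans (etrans _ e) _; field.
rewrite mulrA; have [a0|an] := eqVneq a [::].
  subst a; rewrite mulr1.
  have kE : (k%:R : rat) = ((k - 1)%N%:Z)%:~R + 1 by rewrite -pmulrn natrB //; lra.
  move: hx; rewrite /= addr0 kE; case: b => hx.
    rewrite parent_mxR; do 4 eexists; split; first by [].
    split; [split=> //; nia | split; [nia|]].
    by rewrite !rmorphD !rmorphM /=; lra.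
  rewrite parent_mxL; do 4 eexists; split; first by [].
  split; [split=> //; nia | split; [nia|]].
  by rewrite !rmorphD !rmorphM /=; lra.
rewrite subn0; case: b hx => hx.
  rewrite parent_mxR; apply: IH => //; try nia.
  by rewrite /= !rmorphD !rmorphM /= -!pmulrn; lra.
rewrite parent_mxL; apply: IH => //; try nia.
by rewrite /= !rmorphD !rmorphM /= -!pmulrn; lra.
Qed.

Lemma cf_block_farey x a : 0 < x < 1 -> cf_expansion x a ->
  exists s m r l, parent_mx 1 1 1 0 * cf_block a = parent_mx s m r l
    /\ is_farey_pair x s m r l.
Proof.
move=> /andP[x0 x1] [an a1 _]; case: a an a1 => //= k a _ /andP[k1 a1] ex.
have kR : 0 < (k%:R : rat) by rewrite ltr0n.
have y0 := cf_value_ge0 a.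
have d0 : k%:R + cf_value a != 0 by rewrite gt_eqF // ltr_pwDl.
have {}ex : x * (k%:R + cf_value a) = 1 by rewrite -ex mulVf.
rewrite cf_block_cons.
have [a0|an] := eqVneq a [::].
  subst a; move: ex; rewrite mulr1 /= addr0 parent_mxL => ex.
  (* [x < 1] excludes the expansion [[:: 1]], so that the subtractions are
     exact. *)
  have k2 : (1 < k)%N by rewrite -(ltr_nat rat); nra.
  have kE : (k%:R : rat) = ((k - 1 - 1)%N%:Z)%:~R + 1 + 1.
    by rewrite -pmulrn -subnDA natrB //; lra.
  do 4 eexists; split; first by [].
  split; [split=> //; nia | split; [nia|]].
  by rewrite !rmorphD !rmorphM /=; move: ex; rewrite kE; lra.
have kE : (k%:R : rat) = ((k - 1)%N%:Z)%:~R + 1 by rewrite -pmulrn natrB //; lra.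
rewrite mulrA parent_mxL; apply: alt_block_farey => //; try nia.
by rewrite !rmorphD !rmorphM /=; move: ex; rewrite subn0 kE; lra.
Qed.

Lemma num_den_bezout (n d t u : int) : 0 < d -> t * n + u * d = 1 ->
  numq (n%:~R / d%:~R) = n /\ denq (n%:~R / d%:~R) = d.
Proof.
move=> d0 bez; have cop : coprime `|n| `|d|.
  by rewrite -coprimezE; apply/coprimezP; exists (t, u).
rewrite coprimeq_num // coprimeq_den // gtr0_sg // mul1r gt_eqF //.
by rewrite gtr0_norm.
Qed.

Lemma matrix_farey_parents x s m r l : is_farey_pair x s m r l ->
  exists lf rt, farey_parents x lf rt /\ farey_mx lf rt = parent_mx s m r l.
Proof.
move=> [[s0 m0 l0] [det hx]].
have [nl dl] : numq (l%:~R / m%:~R) = l /\ denq (l%:~R / m%:~R) = m.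
  by apply: (@num_den_bezout _ _ (- s) r) => //; rewrite -det; ring.
have [nr dr] : numq (r%:~R / s%:~R) = r /\ denq (r%:~R / s%:~R) = s.
  by apply: (@num_den_bezout _ _ m (- l)) => //; rewrite -det; ring.
have sm0 : 0 < s + m by lia.
have xE : x = (l + r)%:~R / (m + s)%:~R.
  by apply: (canRL (mulfK _)); [rewrite intr_eq0; lia|rewrite !rmorphD /=; lra].
have [nx dx] : numq x = l + r /\ denq x = m + s.
  rewrite xE.
  by apply: (@num_den_bezout _ _ m (- l)); [lia|rewrite -det; ring].
exists (l%:~R / m%:~R), (r%:~R / s%:~R); split; last first.
  by rewrite /farey_mx nl dl nr dr.
split; rewrite ?nl ?dl ?nr ?dr //.
have mR : 0 < (m%:~R : rat) by rewrite ltr0z.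
have sR : 0 < (s%:~R : rat) by rewrite ltr0z.
apply/andP; split; first by rewrite divr_ge0 // ler0z // ltW.
rewrite ltr_pdivrMr // mulrAC ltr_pdivlMr //.
by rewrite -!rmorphM /= ltr_int; lia.
Qed.

Lemma frak_m_cf s x a : 0 < x < 1 -> cf_expansion x a ->
  frak_m (theta s x) = segment_mx s * parent_mx 1 1 1 0 * cf_block a.
Proof.
move=> x01 hx; have [s' [m [r [l [e fp]]]]] := cf_block_farey _ _ x01 hx.
have [lf [rt [fp' e']]] := matrix_farey_parents _ _ _ _ _ fp.
by rewrite (frak_m_theta s x lf rt) // e' -e mulrA.
Qed.

Lemma frak_m_half s :
  frak_m (theta s (1 / 2)) = segment_mx s * parent_mx 1 1 1 0.
Proof.
have half2 : cf_expansion (1 / 2) [:: 2%N] by [].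
rewrite (@frak_m_cf _ _ [:: 2%N]) //.
by rewrite /cf_block /= big_ord_recl big_ord0 !mulr1.
Qed.

(** * Triangle sequences *)

Lemma segment_mx_cons b w :
  segment_mx (Inner (b :: w)) = phi_mx b * segment_mx (Inner w).
Proof. by rewrite /= -mulmxA. Qed.

(** The matrix [H] above. *)
Local Notation half_mx := (frak_m (1 / 2, 1 / 2)).

Lemma half_mxE : half_mx = segment_mx Sigma * parent_mx 1 1 1 0.
Proof. exact: (frak_m_half Sigma). Qed.

Lemma half_mxL : half_mx * matL = phi_mx true * half_mx.
Proof. by rewrite half_mxE -!mulmxE; mx3_eq. Qed.
Lemma half_mxI : half_mx * matI = phi_mx false * half_mx.
Proof. by rewrite half_mxE -!mulmxE; mx3_eq. Qed.
Lemma half_mxI_Inner :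
  half_mx * matI = segment_mx (Inner [::]) * parent_mx 1 1 1 0.
Proof. by rewrite half_mxE -!mulmxE /= mul1mx; mx3_eq. Qed.

Lemma half_mxLk k : half_mx * matL ^+ k = phi_mx true ^+ k * half_mx.
Proof.
by elim: k => [|k IH]; rewrite ?mulr1 ?mul1r // !exprSr mulrA IH -!mulrA half_mxL.
Qed.

Lemma segment_mx_nseq k w :
  segment_mx (Inner (nseq k true ++ w)) = phi_mx true ^+ k * segment_mx (Inner w).
Proof.
by elim: k => [|k IH]; rewrite ?mul1r // exprS -mulrA -IH -segment_mx_cons.
Qed.

Lemma theta_nseq k w xi :
  theta (Inner (nseq k true ++ w)) xi = iter k phi1 (theta (Inner w) xi).
Proof. by elim: k => //= k ->. Qed.

(** The word [w] such that the points of triangle sequence [alpha] lie on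
    [Inner w], when the last digit [k] is positive: the last block
    [phi1^k phi0 phi2] is [phi1^(k-1)] applied to the parametrization
    [phi1 phi0 phi2] of [Inner [::]]. *)
Fixpoint triangle_word (alpha : seq nat) : seq bool :=
  match alpha with
  | [::] => [::]
  | [:: k] => nseq k.-1 true
  | k :: alpha' => nseq k true ++ false :: triangle_word alpha'
  end.

Lemma triangle_word_theta alpha xi : alpha != [::] -> (0 < last 0%N alpha)%N ->
  foldr (fun k Y => iter k phi1 (phi0 Y)) (phi2 (xi, xi)) alpha
  = theta (Inner (triangle_word alpha)) xi.
Proof.
elim: alpha => // k [|k' alpha] IH _ hlast.
  case: k hlast => // k _; rewrite [triangle_word _]/=.
  rewrite -[nseq k true]cats0 theta_nseq.
  exact: iterSr.
rewrite [triangle_word _]/= theta_nseq.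
by congr (iter k phi1 (phi0 _)); apply: IH.
Qed.

Lemma triangle_block_cons k alpha : triangle_block (k :: alpha)
  = matL ^+ (k - (alpha == [::])) * matI * triangle_block alpha.
Proof.
rewrite /triangle_block big_ord_recl /=; congr (_ ^+ (_ - _) * _ * _).
by case: alpha.
Qed.

Lemma triangle_word_mx alpha : alpha != [::] ->
  segment_mx (Inner (triangle_word alpha)) * parent_mx 1 1 1 0
  = half_mx * triangle_block alpha.
Proof.
elim: alpha => // k [|k' alpha] IH _.
  rewrite triangle_block_cons eqxx subn1 [triangle_block [::]]big_ord0 mulr1.
  rewrite [triangle_word _]/= -[nseq _ _]cats0 segment_mx_nseq mulrA half_mxLk -mulrA.
  by rewrite -half_mxI_Inner mulrA.
rewrite -[triangle_word [:: k, k' & alpha]]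
  /(nseq k true ++ false :: triangle_word (k' :: alpha)).
rewrite segment_mx_nseq segment_mx_cons triangle_block_cons subn0.
move: (segment_mx _) IH => W /(_ isT) IH.
by rewrite -!mulrA IH !mulrA half_mxLk -(mulrA _ half_mx matI) half_mxI !mulrA.
Qed.

Lemma triangle_indexE k X : in_triangle_k k X -> triangle_index X = k.
Proof.
move=> hk; apply: classical_sets.xget_unique => //= k'.
have index_le i j : in_triangle_k i X -> in_triangle_k j X -> (i <= j)%N.
  case/and3P=> /and3P[_ _ y0] hi _ /and3P[_ _ hj].
  by rewrite -ltnS -(ltr_nat rat) -(ltr_pM2r y0); lra.
by move=> hk'; apply/eqP; rewrite eqn_leq !index_le.
Qed.

(** If the last digit is 0, the last point of the orbit that lies in the triangle
    has first coordinate 1.  Its predecessor is then on the diagonal, and a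
    predecessor [(x, y)] of the latter would satisfy [x + (k + 1) y = 1], which
    the strict inequality defining the piece of index [k] excludes.  So [X] is
    one of these two points, hence on a side. *)
Lemma triangle_sequence_last X alpha :
  in_triangle_interior X -> triangle_sequence X alpha -> (0 < last 0%N alpha)%N.
Proof.
move=> /and3P[X1 X2 _] [].
case/lastP: alpha => // alpha k _; rewrite size_rcons last_rcons => tri.
have {}tri j : (j <= size alpha)%N ->
  exists i, [/\ in_triangle_k i (iter j triangle_map X),
    triangle_map (iter j triangle_map X) =
     ((iter j triangle_map X).2 / (iter j triangle_map X).1,
      (1 - (iter j triangle_map X).1 - i%:R * (iter j triangle_map X).2)
       / (iter j triangle_map X).1)
    & j = size alpha -> i = k].
  move=> hj; have h := tri j.
  exists (nth 0%N (rcons alpha k) j); split; first exact: h.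
    by rewrite {1}/triangle_map (triangle_indexE _ _ (h hj)).
  by move=> ->; rewrite nth_rcons ltnn eqxx.
case: k tri => // tri /andP[_].
move: (size alpha) tri => n tri.
have [i [hi ei /(_ erefl) i0]] := tri n (leqnn n).
rewrite {i}i0 in hi ei.
rewrite iterS ei /= mul0r subr0.
case/and3P: hi => /and3P[x1 yx y0] _ _.
have xn0 : (iter n triangle_map X).1 != 0 by lra.
rewrite mulf_eq0 invr_eq0 (negPf xn0) orbF subr_eq0 => /eqP {ei} x1E.
case: n tri x1 yx y0 xn0 x1E => [|n] tri x1 yx y0 xn0 x1E.
  by move: X1; rewrite -[X.1]x1E ltxx.
have [i' [hi' ei' _]] := tri n (leqnSn n).
move: x1E; rewrite iterS ei' /=.
case/and3P: hi' => /and3P[x1' yx' y0'] _ _.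
have x'n0 : (iter n triangle_map X).1 != 0 by lra.
move/esym=> /(canRL (mulfVK x'n0)); rewrite mul1r => diag.
case: n tri {x1 yx y0 xn0 ei'} x1' yx' y0' x'n0 diag
   => [|n] tri x1' yx' y0' x'n0 diag.
  by move: X2; rewrite /= -[X.2]/(iter 0 triangle_map X).2 diag ltxx.
have [i2 [hi2 ei2 _]] := tri n (leq_trans (leqnSn n) (leqnSn n.+1)).
move: diag; rewrite iterS ei2 /=.
case/and3P: hi2 => /and3P[x2 yx2 y2] _ hlt.
have x2n0 : (iter n triangle_map X).1 != 0 by lra.
move/(mulIf (invr_neq0 x2n0)) => e.
by move: hlt; rewrite -natr1; lra.
Qed.

Theorem mainTheorem2 :
  (forall (x : rat) (a : seq nat),
     0 < x < 1 -> cf_expansion x a ->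
     [/\ frak_m (x, x) = frak_m (1 / 2, 1 / 2) * cf_block a,
         frak_m (x, 0) = frak_m (1 / 2, 0) * cf_block a
       & frak_m (1, x) = frak_m (1, 1 / 2) * cf_block a])
  /\
  (forall (X : point) (alpha a : seq nat),
     in_triangle_interior X -> representation X alpha a ->
     frak_m X = frak_m (1 / 2, 1 / 2) * triangle_block alpha * cf_block a).
Proof.
have cf s x a : 0 < x < 1 -> cf_expansion x a ->
    frak_m (theta s x) = frak_m (theta s (1 / 2)) * cf_block a.
  by move=> x01 hx; rewrite frak_m_half; apply: frak_m_cf.
split=> [x a x01 hx|X alpha a Xint [seqX [xi [xi01 XE hxi]]]].
  by split; [exact: (cf Sigma)|exact: (cf Lambda)|exact: (cf Upsilon)].
have hlast := triangle_sequence_last _ _ Xint seqX.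
have [alpha0 _ _] := seqX.
rewrite XE triangle_word_theta // (frak_m_cf _ _ _ xi01 hxi).
by rewrite triangle_word_mx //.
Qed.
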